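(* Let $\pi\in\Pi(\mu,\nu)$ be a $d_N$-cyclically monotone transference plan of finite cost, concentrated on a $\sigma$-compact $d_N$-cyclically monotone set $\Gamma\subset\{d_N<+\infty\}$ satisfying the closedness/boundedness conditions (a), (b) of the context, and let $G,\mathcal T,\mathcal T_e,H$, the sets $A_t$, and the disintegration $\mu\llcorner_{\mathcal T}=\int_S\mu_y\,m(dy)$ be as defined in the context. Assume the following non-degeneracy condition: for each analytic set $A\subset\mathcal T_e$ there exist a sequence $\{t_n\}_{n\in\mathbb N}\subset\mathbb R\setminus\{0\}$ with $t_n\to0$ and a constant $C>0$ such that $\mu(A_{t_n})\ge C\,\mu(A)$ for every $n\in\mathbb N$. Then $\mu(\mathcal T_e\setminus\mathcal T)=0$, and the conditional probabilities $\mu_y$ are continuous (i.e. $\mu_y(\{x\})=0$ for all $x\in X$) for $m$-a.e. $y\in S$.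
   Context: Setting. $(X,d)$ is a Polish space; $d_N:X\times X\to[0,+\infty]$ is a distance (value $+\infty$ allowed) that is Borel with respect to $d\times d$; $(X,d_N)$ is a geodesic space, meaning: there is a class of admissible continuous paths in the topological space $X$ (topology of $d$), closed under restrictions, concatenations and admissible reparametrizations (including linear ones), and a length $L$ on it with values in $[0,+\infty]$ that is additive, such that $t\mapsto L(\gamma\llcorner_{[a,t]})$ is continuous, invariant under admissible reparametrizations, and such that for every $x$ and every neighbourhood $U_x$ the infimum of lengths of admissible paths from $x$ to $X\setminus U_x$ is positive; $d_N(x,y)$ is the infimum of $L$ over admissible paths from $x$ to $y$, and this infimum is attained. $\mu,\nu$ are Borel probability measures on $(X,d)$, $\Pi(\mu,\nu)$ is the set of Borel probabilities on $X\times X$ with marginals $\mu,\nu$; finite cost means $\int d_N\,d\pi<\infty$. $P_i$ denotes projection on the $i$-th factor. A set $\Lambda\subset X\times X$ is $d_N$-cyclically monotone if $\sum_{i=1}^n d_N(x_i,y_i)\le\sum_{i=1}^n d_N(x_{i+1},y_i)$ for all $n$ and $(x_1,y_1),\dots,(x_n,y_n)\in\Lambda$, with $x_{n+1}=x_1$; a plan is $d_N$-cyclically monotone if concentrated on such a set. Transport sets. $\Gamma'$ is the set of $(x,y)$ for which there are $I\in\mathbb N_0$ and $(w_i,z_i)\in\Gamma$, $i=0,\dots,I$, with $z_I=y$, $w_{I+1}=w_0=x$ and $\sum_{i=0}^I \big(d_N(w_{i+1},z_i)-d_N(w_i,z_i)\big)=0$. $G=\{(x,y):\exists (w,z)\in\Gamma',\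 d_N(w,x)+d_N(x,y)+d_N(y,z)=d_N(w,z)\}$, $G^{-1}=\{(x,y):(y,x)\in G\}$, $R=G\cup G^{-1}$. $\mathcal T=P_1(G^{-1}\setminus\{x=y\})\cap P_1(G\setminus\{x=y\})$, $\mathcal T_e=P_1(G^{-1}\setminus\{x=y\})\cup P_1(G\setminus\{x=y\})$; $\mathcal T_e\setminus\mathcal T$ is the set of initial and final points. $H$ is the set of $(x,y)\in\mathcal T_e\times\mathcal T_e$ for which there are $I\in\mathbb N_0$ and $z_1,\dots,z_I\in\mathcal T$ such that, with $z_0=x$, $z_{I+1}=y$, $(z_i,z_{i+1})\in R$ for $0\le i\le I$. $H(x)=\{y:(x,y)\in H\}$. $H\cap(\mathcal T\times\mathcal T)$ is an equivalence relation on $\mathcal T$. Conditions on $\Gamma$: (a) for all $x\in\mathcal T$ and $r>0$, $H(x)\cap\overline{\{y:d_N(x,y)<r\}}^{\,d_N}$ (closure in $d_N$) is $d$-closed; (b) for all $x\in\mathcal T$ there is $r>0$ such that $d_N(x,\cdot)$ is bounded on $H(x)\cap\{y:d(x,y)\le r\}$. Disintegration. Under (a), (b) there is a $\mu$-measurable quotient map $f:\mathcal T\to\mathcal T$ for $H$ ($(x,f(x))\in H$, and $f(x)=f(x')$ if $(x,x')\in H$). Put $m=f_\sharp(\mu\llcorner_{\mathcal T})$, let $S\subset f(\mathcal T)$ be $\sigma$-compact carrying $m$, and let $\mu\llcorner_{\mathcal T}=\int_S\mu_y\,m(dy)$ be the strongly consistent disintegration, $\mu_y$ a probability concentrated on $f^{-1}(y)\subset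 H(y)$. Translation. For $A\subset\mathcal T_e$: $A_t=P_2\{(x,y)\in G\cap(A\times X):d_N(x,y)=t\}$ for $t\ge0$, and $A_t=P_2\{(x,y)\in G^{-1}\cap(A\times X):d_N(x,y)=-t\}$ for $t<0$. *)

(* Defs.v *)
From HB Require Import structures.
From mathcomp Require Import all_boot all_order all_algebra.
From mathcomp Require Import all_classical all_reals all_analysis.
From mathcomp Require Import measurable_realfun.

Set Implicit Arguments.
Unset Strict Implicit.
Unset Printing Implicit Defensive.

Import Order.TTheory GRing.Theory Num.Theory.
Import numFieldNormedType.Exports.

Local Open Scope classical_set_scope.
Local Open Scope ring_scope.

(* A Polish space (X, d) is a separable X : completeMetricType R, with
   d = mdist. *)
#[short(type="completeMetricType")]
HB.structure Definition CompleteMetric (R : numFieldType) :=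
  {M of Metric R M & Complete M}.

Definition separable (T : topologicalType) : Prop :=
  exists2 D : set T, countable D & dense D.

Notation borel T := (g_sigma_algebraType (@open T)).

Definition sigma_compact (T : topologicalType) (A : set T) : Prop :=
  exists2 K : (set T)^nat, (forall n, compact (K n)) & A = \bigcup_n K n.

Definition analytic (R : realType) (X : completeMetricType R) (A : set X) :
    Prop :=
  exists (Y : completeMetricType R) (B : set (X * Y)),
    [/\ separable Y, measurable (B : set (borel (X * Y)%type)) &
        A = fst @` B].

Definition concentrated_on d (T : measurableType d) (R : realType)
    (mu : set T -> \bar R) (A : set T) : Prop :=
  mu.-negligible (~` A).

(* Measurability with respect to the completion of [mu]. *)
Definition ae_measurable d (T : measurableType d) (R : realType)
    (mu : set T -> \bar R) (D : set T) (g : T -> \bar R) : Prop :=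
  exists2 g' : T -> \bar R,
    measurable_fun setT g' & {ae mu, forall y, D y -> g y = g' y}.

Definition extended_distance (R : realType) (X : Type) (dN : X -> X -> \bar R) :
    Prop :=
  [/\ forall x y, (0 <= dN x y)%E,
      forall x y, dN x y = 0%E <-> x = y,
      forall x y, dN x y = dN y x &
      forall x y z, (dN x z <= dN x y + dN y z)%E].

(* The path gamma : [a, b] -> X is represented by a, b and a total function
   R -> X whose values outside [a, b] are irrelevant (fields [adm_ext] and
   [len_ext]); an admissible reparametrization phi : [c, d] -> [a, b] is
   represented in the same way. *)
Record length_structure (R : realType) (X : topologicalType) := LengthStructure {
  adm : R -> R -> (R -> X) -> Prop ;
  reparam : R -> R -> R -> R -> (R -> R) -> Prop ;
  len : R -> R -> (R -> X) -> \bar R ;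

  adm_le : forall a b g, adm a b g -> a <= b ;
  adm_continuous : forall a b g, adm a b g -> {within `[a, b], continuous g} ;
  adm_ext : forall a b g g', (forall t, a <= t <= b -> g t = g' t) ->
    adm a b g -> adm a b g' ;
  len_ext : forall a b g g', (forall t, a <= t <= b -> g t = g' t) ->
    adm a b g -> len a b g = len a b g' ;

  adm_restrict : forall a b c d g, adm a b g ->
    a <= c -> c <= d -> d <= b -> adm c d g ;
  adm_concat : forall a b c g, adm a c g -> adm c b g -> adm a b g ;

  (* a continuous bijection between compact intervals is a homeomorphism *)
  reparam_homeo : forall c d a b phi, reparam c d a b phi ->
    [/\ c <= d, a <= b, {within `[c, d], continuous phi} &
        set_bij `[c, d] `[a, b] phi] ;
  reparam_linear : forall c d a b k l : R, k != 0 -> c <= d -> a <= b ->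
    set_bij `[c, d] `[a, b] (fun t => k * t + l) ->
    reparam c d a b (fun t => k * t + l) ;
  adm_reparam : forall c d a b phi g, reparam c d a b phi -> adm a b g ->
    adm c d (g \o phi) ;

  len_ge0 : forall a b g, adm a b g -> (0 <= len a b g)%E ;
  len_additive : forall a b c g, adm a b g -> a <= c <= b ->
    (len a b g = len a c g + len c b g)%E ;
  len_continuous : forall a b g, adm a b g ->
    {within `[a, b], continuous (fun t => len a t g)} ;
  len_reparam : forall c d a b phi g, reparam c d a b phi -> adm a b g ->
    len c d (g \o phi) = len a b g ;
  len_topology : forall (x : X) (U : set X), nbhs x U ->
    (0 < ereal_inf [set l | exists a b g,
           [/\ adm a b g, g a = x, ~ U (g b) & l = len a b g]])%E }.

(* When dN x y = +oo there may be no admissible path from x to y at all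
   (infimum of the empty set), so attainment is asked for dN x y < +oo. *)
Definition geodesic (R : realType) (X : topologicalType)
    (dN : X -> X -> \bar R) : Prop :=
  exists Ls : length_structure R X, forall x y,
    let L := [set l | exists a b g,
      [/\ adm Ls a b g, g a = x, g b = y & l = len Ls a b g]] in
    dN x y = ereal_inf L /\ ((dN x y < +oo)%E -> L (dN x y)).

Section transport.
Context (R : realType) (X : completeMetricType R).
Variable dN : X -> X -> \bar R.

Definition coupling (mu nu : probability (borel X) R)
    (pi : probability (borel (X * X)%type) R) : Prop :=
  forall A : set (borel X), measurable A ->
    pi (fst @^-1` A) = mu A /\ pi (snd @^-1` A) = nu A.

Definition cyclically_monotone (L : set (X * X)) : Prop :=
  forall (n : nat) (x y : nat -> X),
    (forall i, (i < n)%N -> L (x i, y i)) -> x n = x 0%N ->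
    (\sum_(i < n) dN (x i) (y i) <= \sum_(i < n) dN (x i.+1) (y i))%E.

(* Closure in the topology generated by the [dN]-balls. *)
Definition dN_closure (A : set X) : set X :=
  [set y | forall e : R, 0 < e -> exists2 z, A z & (dN y z < e%:E)%E].

Definition diag : set (X * X) := [set p | p.1 = p.2].

Definition rel_inv (A : set (X * X)) : set (X * X) := [set p | A (p.2, p.1)].

Variable Gamma : set (X * X).

Definition Gamma' : set (X * X) :=
  [set p | exists (I : nat) (w z : nat -> X),
    [/\ forall i, (i <= I)%N -> Gamma (w i, z i),
        z I = p.2, w I.+1 = p.1, w 0%N = p.1 &
        (\sum_(i < I.+1) (dN (w i.+1) (z i) - dN (w i) (z i)) = 0)%E]].

Definition Grel : set (X * X) :=
  [set p | exists2 q, Gamma' q &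
    (dN q.1 p.1 + dN p.1 p.2 + dN p.2 q.2 = dN q.1 q.2)%E].

Definition Rrel : set (X * X) := Grel `|` rel_inv Grel.

Definition Tset : set X :=
  fst @` (rel_inv Grel `\` diag) `&` fst @` (Grel `\` diag).

Definition Te : set X :=
  fst @` (rel_inv Grel `\` diag) `|` fst @` (Grel `\` diag).

Definition Hrel : set (X * X) :=
  [set p | [/\ Te p.1, Te p.2 & exists (I : nat) (z : nat -> X),
    [/\ z 0%N = p.1, z I.+1 = p.2,
        forall i, (1 <= i <= I)%N -> Tset (z i) &
        forall i, (i <= I)%N -> Rrel (z i, z i.+1)]]].

Definition translate (A : set X) (t : R) : set X :=
  if 0 <= t then snd @` [set p | [/\ Grel p, A p.1 & dN p.1 p.2 = t%:E]]
  else snd @` [set p | [/\ rel_inv Grel p, A p.1 & dN p.1 p.2 = (- t)%:E]].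

Definition chains_closed : Prop :=
  forall (x : X) (r : R), Tset x -> 0 < r ->
    closed [set y | Hrel (x, y) /\ dN_closure [set y' | (dN x y' < r%:E)%E] y].

Definition chains_locally_bounded : Prop :=
  forall x : X, Tset x -> exists r M : R, 0 < r /\
    forall y, Hrel (x, y) -> mdist x y <= r -> (dN x y <= M%:E)%E.

(* For arbitrary A, [mu_ext mu A] is the outer measure of A; on the
   mu-measurable sets, and in particular on the analytic ones, it is the
   completion of mu. *)
Definition translation_nondegenerate (mu : probability (borel X) R) : Prop :=
  forall A : set X, analytic A -> A `<=` Te ->
    exists (t : nat -> R) (C : R),
      [/\ forall n, t n != 0, t @ \oo --> (0 : R), 0 < C &
          forall n, (C%:E * mu_ext mu A <= mu_ext mu (translate A (t n)))%E].

(* f : Tset -> Tset; the values of f outside Tset are irrelevant. *)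
Definition quotient_map (mu : probability (borel X) R) (f : X -> X) : Prop :=
  [/\ forall x, Tset x -> Tset (f x) /\ Hrel (x, f x),
      forall x x', Tset x -> Tset x' -> Hrel (x, x') -> f x = f x' &
      forall B : set (borel X), measurable B ->
        (mu_ext mu).-caratheodory (Tset `&` f @^-1` B)].

Definition quotient_measure (mu : probability (borel X) R) (f : X -> X)
    (m : {measure set (borel X) -> \bar R}) : Prop :=
  forall B : set (borel X), measurable B ->
    m B = mu_ext mu (Tset `&` f @^-1` B).

(* Only the mu_ y with y in S matter. *)
Definition strongly_consistent_disintegration (mu : probability (borel X) R)
    (f : X -> X) (m : {measure set (borel X) -> \bar R}) (S : set X)
    (mu_ : X -> probability (borel X) R) : Prop :=
  [/\ forall B : set (borel X), measurable B ->
        ae_measurable m S (fun y => mu_ y B),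
      forall B : set (borel X), measurable B ->
        mu_ext mu (B `&` Tset) = (\int[m]_(y in S) mu_ y B)%E &
      {ae m, forall y, S y ->
        concentrated_on (mu_ y) (Tset `&` f @^-1` [set y])}].

End transport.

(* Main.v *)
Require Import Defs.
From mathcomp Require Import all_boot all_order all_algebra.
From mathcomp Require Import all_classical all_reals all_analysis.
From mathcomp Require Import measurable_realfun.
From mathcomp Require Import lra.

Set Implicit Arguments.
Unset Strict Implicit.
Unset Printing Implicit Defensive.

Import Order.TTheory GRing.Theory Num.Theory.
Import numFieldNormedType.Exports.

Local Open Scope classical_set_scope.
Local Open Scope ring_scope.

(** Call a set an antichain if no two distinct points of it are related by
[Rrel].  Everything follows from one fact ([antichain_null]): under the
non-degeneracy condition a mu-measurable antichain [A] included in [Te] is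
mu-negligible.  Indeed, if [A] has positive measure, it contains a closed set
[E] of positive measure.  The translate of [E] by [t] with [t != 0] is disjoint
from [E], because its points are related to points of [E] at [dN]-distance
[`|t|].  On the other hand [dN] induces a topology finer than that of [X], because
the admissible paths from a point to the complement of a neighbourhood have
lengths bounded away from 0, and [E] can be chosen, as in Egorov's theorem, such
that this comparison is uniform on [E] ([mu_ext_bigcap_approx]).  Hence the translates by [t n] with [t n --> 0]
lie, for large [n], in any given metric neighbourhood of [E], minus [E], and
these sets decrease to the empty set.  So their measure tends to 0, whereas it
is at least [C * mu E].

The initial points form an antichain, and so do the final points, which gives
the first assertion.  For the second one, a probability [mu_ y] with an atom [x]
admits a basic open set [U k] containing [x] in which [x] carries at least two
thirds of the mass.  There is at most one such [x] for given [y] and [k], since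
two of them would carry four thirds of the mass.  As [f] is constant on the
classes of [Hrel], the set of all these points, for fixed [k], is an antichain,
hence mu-negligible.  Integrating the conditional probabilities of a Borel null
set that contains it shows that almost no [mu_ y] charges it.

Measurability is the remaining issue: the endpoints and the sets of points
where the two topologies compare uniformly are defined by projections of Borel
sets.  Such sets are Souslin, that is, projections along [nat -> nat] of closed
sets ([souslin_projection], [borel_bisouslin]), and the outer measure of a
Souslin set is the supremum of the measures of its closed subsets
([souslin_inner_closed]), which implies Caratheodory measurability. *)

(** * Souslin sets *)

(** Continuity in the sequence, for the product of the discrete topologies; it is
all that is ever needed from the topology of the Baire space. *)
Definition finitely_determined (Z : Type) (P : (nat -> nat) -> set Z) : Prop :=
  forall s, exists N, forall t, (forall i, (i < N)%N -> t i = s i) -> P t = P s.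

(** A countable family of conditions, each closed in [z] and locally constant in
[s], describes exactly a closed subset of the product of [Z] and the Baire
space, so this is the projection of such a set.  Splitting the closed set into
countably many conditions makes countable intersections immediate. *)
Definition souslin (Z : topologicalType) (A : set Z) : Prop :=
  exists P : nat -> (nat -> nat) -> set Z,
    [/\ forall j s, closed (P j s), forall j, finitely_determined (P j) &
        A = [set z | exists s, forall j, P j s z]].

Lemma finitely_determined_cst (Z : Type) (A : set Z) :
  finitely_determined (fun=> A).
Proof. by move=> s; exists 0%N. Qed.

Lemma finitely_determined_reindex (Z : Type) (P : (nat -> nat) -> set Z)
    (r : nat -> nat) :
  finitely_determined P -> finitely_determined (fun s => P (s \o r)).
Proof.
move=> fP s; have [N PN] := fP (s \o r).
exists (\max_(i < N) (r i).+1)%N => t ts; apply: PN => i iN /=; apply: ts.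
exact: (leq_trans _ (leq_bigmax (Ordinal iN))).
Qed.

Lemma finitely_determined_preimage (W Z : Type) (f : W -> Z)
    (P : (nat -> nat) -> set Z) :
  finitely_determined P -> finitely_determined (fun s => f @^-1` P s).
Proof. by move=> fP s; have [N PN] := fP s; exists N => t /PN ->. Qed.

Section souslin_operations.
Context {Z : topologicalType}.
Implicit Type A : set Z.

Lemma closed_souslin A : closed A -> souslin A.
Proof.
move=> cA; exists (fun _ _ => A); split => //.
- by move=> _; exact: finitely_determined_cst.
- by apply/seteqP; split => [z Az|z [s /(_ 0%N)]//]; exists (fun=> 0%N).
Qed.

Lemma souslin_preimage (W : topologicalType) (f : W -> Z) A :
  continuous f -> souslin A -> souslin (f @^-1` A).
Proof.
move=> cf [P [cP fP ->]]; exists (fun j s => f @^-1` P j s); split.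
- by move=> j s; apply: (closed_comp _ (cP j s)) => x _; exact: cf.
- by move=> j; exact: finitely_determined_preimage.
- by [].
Qed.

(** Pairing of indices: one sequence codes a sequence of sequences. *)
Let component (n i : nat) : nat := pickle (n, i).

(** Countably many witnesses are coded by a single one. *)
Lemma souslin_bigcap (F : nat -> set Z) :
  (forall n, souslin (F n)) -> souslin (\bigcap_n F n).
Proof.
move=> /choice[P PF].
exists (fun j s => if unpickle j is Some (n, k)
  then P n k (s \o component n) else setT); split.
- by move=> j s; case: unpickle => [[n k]|]; [case: (PF n)|exact: closedT].
- move=> j; case: unpickle => [[n k]|]; last exact: finitely_determined_cst.
  by apply: finitely_determined_reindex; case: (PF n).
- apply/seteqP; split => [z Fz|z [s Ps] n _].
    have /choice[s sP] : forall n, exists s, forall k, P n k s z.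
      by move=> n; have := Fz n I; case: (PF n) => _ _ ->.
    exists (fun i => if unpickle i is Some (n, k) then s n k else 0%N) => j.
    case: unpickle => [[n k]|//]; rewrite (_ : _ \o _ = s n)//.
    by apply/funext => i /=; rewrite pickleK.
  case: (PF n) => _ _ ->; exists (s \o component n) => k.
  by have := Ps (pickle (n, k)); rewrite pickleK.
Qed.

(** The first term of the witness selects the member of the union; this is why
the finite part of [s] that determines a condition may depend on [s]. *)
Lemma souslin_bigcup (F : nat -> set Z) :
  (forall n, souslin (F n)) -> souslin (\bigcup_n F n).
Proof.
move=> /choice[P PF].
exists (fun j s => P (s 0%N) j (s \o S)); split.
- by move=> j s; case: (PF (s 0%N)).
- move=> j s.
  have [_ /(_ j) + _] := PF (s 0%N).
  move=> /(@finitely_determined_reindex _ _ S)/(_ s)[N PN].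
  exists N.+1 => t ts; rewrite (ts 0%N)//; apply: PN => i iN.
  exact/ts/(leq_trans iN).
- apply/seteqP; split => [z [n _]|z [s Ps]].
    case: (PF n) => _ _ -> [s sP].
    by exists (fun i => if i is k.+1 then s k else n) => j; exact: sP.
  by exists (s 0%N) => //; case: (PF (s 0%N)) => _ _ ->; exists (s \o S).
Qed.

Lemma souslinI A B : souslin A -> souslin B -> souslin (A `&` B).
Proof.
move=> sA sB; rewrite -bigcap2E; apply: souslin_bigcap => -[|[|n]]//=.
exact/closed_souslin/closedT.
Qed.

End souslin_operations.

(** * Projections *)

(** An abstract form of what is used about Polish spaces: a point is the limit of
a decreasing sequence of sets indexed by the finite initial parts of a sequence
of integers, and each such decreasing sequence of nonempty sets converges. *)
Definition souslin_space (Y : topologicalType) : Prop :=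
  exists B : nat -> (nat -> nat) -> set Y,
    [/\ forall k, finitely_determined (B k),
        forall y, exists t, forall k, B k t y &
        forall t, (forall k, exists y, forall i, (i <= k)%N -> B i t y) ->
          exists y : Y, forall V, nbhs y V ->
            exists k, forall y', (forall i, (i <= k)%N -> B i t y') -> V y'].

(** A witness for the projection is a witness for [A] together with a code of [y].
The code is only required to be compatible with [A] up to order [k], for all
[k], and up to closure in [z]; convergence of the coding sets then yields [y],
and closedness of the conditions yields membership in the limit. *)
Lemma souslin_projection (Z Y : topologicalType) (A : set (Z * Y)) :
  souslin_space Y -> souslin A -> souslin [set z | exists y, A (z, y)].
Proof.
move=> [B [fB coverB complB]] [P [cP fP ->]].
pose lft (i : nat) := i.*2; pose rgt (i : nat) := i.*2.+1.
pose slice (k : nat) (s : nat -> nat) : set Z := [set z | exists y, forall i,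
  (i <= k)%N -> B i (s \o lft) y /\ P i (s \o rgt) (z, y)].
exists (fun k s => closure (slice k s)); split.
- by move=> k s; exact: closed_closure.
- move=> k s.
  have /choice[N1 N1B] := fun i => finitely_determined_reindex lft (fB i) s.
  have /choice[N2 N2P] := fun i => finitely_determined_reindex rgt (fP i) s.
  exists (\max_(i < k.+1) maxn (N1 i) (N2 i)) => t ts.
  congr closure; rewrite /slice; apply/funext => z; apply/propext.
  have e1 i : (i <= k)%N -> B i (t \o lft) = B i (s \o lft).
    move=> ik; apply: N1B => j jN; apply: ts; apply: (leq_trans jN).
    apply: (leq_trans (leq_maxl _ (N2 i))).
    exact: (@leq_bigmax _ (fun i : 'I_k.+1 => maxn (N1 i) (N2 i))
      (Ordinal (ik : (i < k.+1)%N))).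
  have e2 i : (i <= k)%N -> P i (t \o rgt) = P i (s \o rgt).
    move=> ik; apply: N2P => j jN; apply: ts; apply: (leq_trans jN).
    apply: (leq_trans (leq_maxr (N1 i) _)).
    exact: (@leq_bigmax _ (fun i : 'I_k.+1 => maxn (N1 i) (N2 i))
      (Ordinal (ik : (i < k.+1)%N))).
  by split => -[y yz]; exists y => i ik; have := yz i ik; rewrite e1// e2.
- apply/seteqP; split => [z [y [s Ps]]|z [s zs]].
    have [t tB] := coverB y.
    exists (fun i => if odd i then s i./2 else t i./2) => k.
    apply: subset_closure; exists y => i _; split.
      rewrite (_ : _ \o _ = t)//; apply/funext => j /=.
      by rewrite odd_double doubleK.
    rewrite (_ : _ \o _ = s)//; apply/funext => j /=.
    by rewrite odd_double/= uphalf_double.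
  have [|y yB] := complB (s \o lft).
    move=> k; have [z' [[y By] _]] := zs k setT filterT.
    by exists y => i /By[].
  exists y, (s \o rgt) => j; apply: contrapT => nP.
  have : nbhs (z, y) (~` P j (s \o rgt)).
    by apply: open_nbhs_nbhs; split => //; exact/closed_openC/cP.
  move=> [[U V] /= [Uz Vy] UV].
  have [k kV] := yB V Vy.
  have [z' [[y' Hy'] Uz']] := zs (maxn j k) U Uz.
  apply: (UV (z', y')); first split => //=.
    apply: kV => i ik.
    by have [|//] := Hy' i; rewrite leq_max ik orbT.
  by have [|//] := Hy' j; rewrite leq_max leqnn.
Qed.

(** Chains of points of arbitrary length are quantified over as sequences, which
is why sequence spaces are needed. *)
Lemma souslin_space_ptws (Y : uniformType) :
  souslin_space Y -> souslin_space {ptws nat -> Y}.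
Proof.
move=> [B [fB coverB complB]].
pose component (n i : nat) : nat := pickle (n, i).
exists (fun j t => if unpickle j is Some (n, k)
  then [set w | B k (t \o component n) (w n)] else setT); split.
- move=> j; case: unpickle => [[n k]|]; last exact: finitely_determined_cst.
  exact: (finitely_determined_preimage (fun w : nat -> Y => w n)
    (finitely_determined_reindex (component n) (fB k))).
- move=> w; have /choice[t tB] := fun n => coverB (w n).
  exists (fun i => if unpickle i is Some (n, k) then t n k else 0%N) => j.
  case: unpickle => [[n k]|//] /=; rewrite (_ : _ \o _ = t n)//.
  by apply/funext => i /=; rewrite pickleK.
- move=> t neB.
  have lemk (n k : nat) : exists K, forall w : nat -> Y,
      (forall j, (j <= K)%N -> (if unpickle j is Some (n, k)
        then [set w | B k (t \o component n) (w n)] else setT) w) ->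
      forall i, (i <= k)%N -> B i (t \o component n) (w n).
    exists (\max_(i < k.+1) component n i)%N => w wB i ik.
    have := wB (component n i); rewrite pickleK; apply.
    exact: (@leq_bigmax _ (fun i : 'I_k.+1 => component n i)
      (Ordinal (ik : (i < k.+1)%N))).
  have /choice[w wB] : forall n, exists y : Y, forall V, nbhs y V ->
      exists k, forall y', (forall i, (i <= k)%N -> B i (t \o component n) y') -> V y'.
    move=> n; apply: complB => k.
    by have [K KB] := lemk n k; have [w /KB] := neB K; exists (w n).
  exists w.
  pose F : set_system (nat -> Y) := filter_from setT
    (fun K : nat => [set w | forall j, (j <= K)%N -> (if unpickle j is Some (n, k)
        then [set w | B k (t \o component n) (w n)] else setT) w]).
  have FF : Filter F.
    apply: filter_from_filter; first by exists 0%N.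
    move=> i j _ _; exists (maxn i j) => // v vB; split => l li; apply: vB;
      by rewrite leq_max li ?orbT.
  suff : {ptws, F --> w} by move=> Fw V /Fw [K _ KV]; exists K.
  apply/pointwise_cvgP => n V /(wB n)[k kV].
  by have [K KB] := lemk n k; exists K => // v /KB/kV.
Qed.

Lemma separable_dense_sequence (R : realType) (X : completeMetricType R) :
  separable X ->
  exists q : nat -> X, forall x (e : R), 0 < e -> exists n, ball x e (q n).
Proof.
move=> [D /countable_injP[g ginj] dD].
exists (fun n => xget point [set x | D x /\ g x = n]) => x e e0.
have [||y [xy Dy]] := dD (ball x e)^°.
- by exists x; exact: nbhsx_ballx.
- exact: open_interior.
exists (g y); rewrite (_ : xget _ _ = y); first exact: interior_subset.
case: xgetP => [z _ [Dz]|/(_ y)[]//].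
by apply: ginj; rewrite inE.
Qed.

(** A point is coded by the indices of points of a dense sequence approaching it;
the nested balls meet by completeness. *)
Lemma polish_souslin_space (R : realType) (X : completeMetricType R) :
  separable X -> souslin_space X.
Proof.
move=> /separable_dense_sequence[q dq].
exists (fun k t => ball (q (t k)) k.+1%:R^-1); split.
- by move=> k s; exists k.+1 => t /(_ k) ->.
- move=> y; suff /choice[t tB] : forall k : nat, exists i, ball (q i) k.+1%:R^-1 y.
    by exists t.
  move=> k; have k0 : 0 < k.+1%:R^-1 :> R by [].
  by have [n /ball_sym yn] := dq y _ k0; exists n.
- move=> t /choice[u uB].
  have close k y y' : ball (q (t k)) k.+1%:R^-1 y ->
      ball (q (t k)) k.+1%:R^-1 y' -> ball y (2 * k.+1%:R^-1) y'.
    by move=> /ball_sym yq /(ball_triangle yq); rewrite mulr_natl mulr2n.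
  have smallk (e : R) : 0 < e -> exists k : nat, 2 * k.+1%:R^-1 < e.
    move=> e0; have [k _ /(_ k (leqnn k)) kP] :=
      near_infty_natSinv_lt (PosNum (divr_gt0 e0 (ltr0n R 2))).
    by exists k; rewrite mulrC -ltr_pdivlMr.
  have /cvg_ex[y uy] : cvg (u @ \oo).
    apply/cauchy_cvgP/cauchy_ballP => e e0.
    have [k ke] := smallk e e0.
    pose U := [set u j | j in [set j | (k <= j)%N]].
    exists (U, U) => /=.
      by split; exists k => // j kj; exists j.
    move=> [_ _] [[i ki <-] [j kj <-]]; apply: (le_ball (ltW ke)).
    by apply: (close k); exact: uB.
  exists y => V; rewrite -nbhs_ballE => -[e /= e0 yV].
  have e20 : 0 < e / 2 by rewrite divr_gt0.
  have [k ke] := smallk (e / 2) e20.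
  exists k => y' y'B; apply: yV.
  have [j _ /(_ (maxn j k))] := uy _ (nbhsx_ballx y (e / 2) e20).
  rewrite /= leq_maxl => /(_ isT) yu.
  rewrite (splitr e); apply: (ball_triangle yu); apply: (le_ball (ltW ke)).
  by apply: (close k); [exact/uB/leq_maxr | exact: y'B].
Qed.

(** * Borel sets *)

Section borel_souslin.
Context {R : realType} (Z : pseudoMetricType R).

(** Souslin sets are not closed under complement; these form a sigma-algebra. *)
Definition bisouslin (W : topologicalType) (A : set W) : Prop :=
  souslin A /\ souslin (~` A).

Lemma open_souslin (A : set Z) : open A -> souslin A.
Proof.
move=> oA.
rewrite (_ : A = \bigcup_n closure [set z | ball z n.+1%:R^-1 `<=` A]).
  by apply: souslin_bigcup => n; exact/closed_souslin/closed_closure.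
apply/seteqP; split => [z Az|z [n _]].
  have : nbhs z A by exact: open_nbhs_nbhs.
  rewrite -nbhs_ballE => -[e /= e0 zA].
  have [n _ /(_ n (leqnn n)) ne] := near_infty_natSinv_lt (PosNum e0).
  exists n => //; apply: subset_closure => z' zz'; apply: zA.
  exact: (le_ball (ltW ne)).
have n0 : 0 < n.+1%:R^-1 :> R by [].
by move=> /(_ _ (nbhsx_ballx z _ n0))[z' [z'A /ball_sym/z'A]].
Qed.

Lemma sigma_algebra_bisouslin (W : topologicalType) :
  sigma_algebra setT (@bisouslin W).
Proof.
split.
- by split; rewrite ?setC0; apply: closed_souslin; [exact: closed0|exact: closedT].
- by move=> A [sA sCA]; rewrite setTD; split => //; rewrite setCK.
- move=> F sF; split; first by apply: souslin_bigcup => n; case: (sF n).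
  by rewrite setC_bigcup; apply: souslin_bigcap => n; case: (sF n).
Qed.

Lemma borel_bisouslin (A : set Z) : <<s @open Z >> A -> bisouslin A.
Proof.
apply: (@smallest_sub _ (sigma_algebra setT) _ (@bisouslin Z)).
  exact: sigma_algebra_bisouslin.
move=> U oU; split; first exact: open_souslin.
by apply: closed_souslin; exact: open_closedC.
Qed.

End borel_souslin.

Lemma bisouslin_preimage (W Z : topologicalType) (h : W -> Z) (A : set Z) :
  continuous h -> bisouslin A -> bisouslin (h @^-1` A).
Proof.
move=> ch [sA sCA]; split; first exact: (souslin_preimage ch sA).
exact: (souslin_preimage ch sCA).
Qed.

Lemma measurable_g_sigma_algebra (T : pointedType) (G : set_system T) :
  sigma_algebra setT G ->
  forall A : set (g_sigma_algebraType G), measurable A -> G A.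
Proof. by move=> sG A mA; have := smallest_sub sG (@subset_refl _ G); apply. Qed.

(** With [G] the sets of [bisouslin], the calculus of measurable functions applies
to conditions on [dN] over any product of copies of [X], sequence spaces
included. *)
Lemma measurable_fun_g_sigma_algebra (T : pointedType) (G : set_system T)
    d (U : measurableType d) (f : T -> U) :
  (forall Y, measurable Y -> G (f @^-1` Y)) ->
  measurable_fun setT (f : g_sigma_algebraType G -> U).
Proof. by move=> fG _ Y mY; rewrite setTI; apply: sub_sigma_algebra; exact: fG. Qed.

Lemma continuous_fst_comp (A B C : topologicalType) (h : A -> B * C) :
  continuous h -> continuous (fun a => (h a).1).
Proof. by move=> ch a; apply: (continuous_comp (ch a)); exact: cvg_fst. Qed.

Lemma continuous_snd_comp (A B C : topologicalType) (h : A -> B * C) :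
  continuous h -> continuous (fun a => (h a).2).
Proof. by move=> ch a; apply: (continuous_comp (ch a)); exact: cvg_snd. Qed.

(** * Souslin sets of a transport problem *)

Section transport_souslin.
Context {R : realType} {X : completeMetricType R} (sepX : separable X).
Context (dN : X -> X -> \bar R).
Hypothesis dN_borel : measurable_fun setT
  ((fun p => dN p.1 p.2) : borel (X * X)%type -> \bar R).
Hypothesis dN_dist : extended_distance dN.

Let bisouslin_dN (W : topologicalType) (f g : W -> X) (Y : set (\bar R)) :
  continuous f -> continuous g -> measurable Y ->
  bisouslin [set w | Y (dN (f w) (g w))].
Proof.
move=> cf cg mY.
have cfg : continuous (fun w => (f w, g w)).
  by move=> w; exact: (cvg_pair (cf w) (cg w)).
apply: (bisouslin_preimage cfg (A := (fun p => dN p.1 p.2) @^-1` Y)).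
apply: borel_bisouslin.
by have := dN_borel measurableT mY; rewrite setTI.
Qed.

Lemma Grel_souslin (Gamma : set (X * X)) :
  souslin (Gamma' dN Gamma) -> souslin (Grel dN Gamma).
Proof.
move=> sG'.
pose W := (X * X * X * X)%type.
pose D (f g : W -> X) : g_sigma_algebraType (@bisouslin W) -> \bar R :=
  fun w => dN (f w) (g w).
have mD f g : continuous f -> continuous g -> measurable_fun setT (D f g).
  move=> cf cg; apply: measurable_fun_g_sigma_algebra => Y mY.
  exact: bisouslin_dN.
pose x1 (w : W) := w.1.1.1; pose x2 (w : W) := w.1.1.2.
pose y1 (w : W) := w.1.2; pose y2 (w : W) := w.2.
have c0 : continuous (fun w : W => w) by move=> w; exact: cvg_id.
have c1 := continuous_fst_comp c0.
have c11 := continuous_fst_comp c1.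
have cx1 : continuous x1 := continuous_fst_comp c11.
have cx2 : continuous x2 := continuous_snd_comp c11.
have cy1 : continuous y1 := continuous_snd_comp c1.
have cy2 : continuous y2 := continuous_snd_comp c0.
have [sE _] : bisouslin
    [set w : W | (D y1 x1 w + D x1 x2 w + D x2 y2 w = D y1 y2 w)%E].
  apply: (measurable_g_sigma_algebra (@sigma_algebra_bisouslin W)).
  rewrite -[X in measurable X]setTI; apply: measurable_eqe => //; last exact: mD.
  by apply: emeasurable_funD; [apply: emeasurable_funD|]; exact: mD.
have sP : souslin [set w : W | Gamma' dN Gamma (y1 w, y2 w)].
  apply: (@souslin_preimage _ _ (fun w => (y1 w, y2 w))) sG'.
  by move=> w; exact: (cvg_pair (cy1 w) (cy2 w)).
have sX := polish_souslin_space sepX.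
have := souslin_projection sX (souslin_projection sX (souslinI sP sE)).
congr souslin; apply/seteqP; split => [p [a [b [Gab abE]]]|p [[a b] Gab abE]].
  by exists (a, b).
by exists a, b.
Qed.

(** Equality is a Borel condition, as the vanishing of [dN]. *)
Let bisouslin_eq (W : topologicalType) (f g : W -> X) :
  continuous f -> continuous g -> bisouslin [set w | f w = g w].
Proof.
move=> cf cg; rewrite (_ : mkset _ = [set w | [set 0%E] (dN (f w) (g w))]).
  exact: bisouslin_dN.
have [_ dN0 _ _] := dN_dist.
by apply/seteqP; split => w /=; rewrite dN0.
Qed.

Lemma sigma_compact_souslin (Y : topologicalType) (A : set Y) :
  hausdorff_space Y -> sigma_compact A -> souslin A.
Proof.
move=> hY [K cK ->]; apply: souslin_bigcup => n.
by apply: closed_souslin; exact: compact_closed.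
Qed.

Lemma hausdorff_space_metric_prod : hausdorff_space (X * X)%type.
Proof.
move=> [x1 x2] [y1 y2] xy; congr pair; apply: (@metric_hausdorff _ X).
  move=> U V xU yV.
  have [||[z1 z2] [[Uz _] [Vz _]]] := xy (U `*` setT) (V `*` setT).
  - by exists (U, setT) => //; split => //=; exact: filterT.
  - by exists (V, setT) => //; split => //=; exact: filterT.
  - by exists z1.
move=> U V xU yV.
have [||[z1 z2] [[_ Uz] [_ Vz]]] := xy (setT `*` U) (setT `*` V).
- by exists (setT, U) => //; split => //=; exact: filterT.
- by exists (setT, V) => //; split => //=; exact: filterT.
- by exists z2.
Qed.

(** For a fixed length [I] of the chain, the conditions on the two sequences [w]
and [z] are closed or Borel; the pair of sequences is then projected out. *)
Lemma Gamma'_souslin (Gamma : set (X * X)) :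
  sigma_compact Gamma -> souslin (Gamma' dN Gamma).
Proof.
move=> scG; have sG := sigma_compact_souslin hausdorff_space_metric_prod scG.
pose W := (X * X * {ptws nat -> X} * {ptws nat -> X})%type.
pose mW := g_sigma_algebraType (@bisouslin W).
have c0 : continuous (fun a : W => a) by move=> a; exact: cvg_id.
have c1 := continuous_fst_comp c0.
have c11 := continuous_fst_comp c1.
have cx1 := continuous_fst_comp c11.
have cx2 := continuous_snd_comp c11.
have cw i : continuous (fun a : W => a.1.2 i).
  move=> a; apply: (@continuous_comp W {ptws nat -> X} X (fun a => a.1.2)
    (fun w => w i)); first exact: (continuous_snd_comp c1).
  exact: (@proj_continuous nat (fun=> X) i).
have cz i : continuous (fun a : W => a.2 i).
  move=> a; apply: (@continuous_comp W {ptws nat -> X} X (fun a => a.2)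
    (fun w => w i)); first exact: (continuous_snd_comp c0).
  exact: (@proj_continuous nat (fun=> X) i).
pose sumW I (a : mW) := (\sum_(i < I.+1)
  (dN ((a : W).1.2 i.+1) ((a : W).2 i) - dN ((a : W).1.2 i) ((a : W).2 i)))%E.
have mD f g : continuous f -> continuous g ->
    measurable_fun setT (fun a : mW => dN (f a) (g a)).
  move=> cf cg; apply: measurable_fun_g_sigma_algebra => Y mY.
  exact: bisouslin_dN.
pose C I := \bigcap_i [set a : W | (i <= I)%N -> Gamma (a.1.2 i, a.2 i)].
pose E I := [set a : W | a.2 I = a.1.1.2] `&` [set a : W | a.1.2 I.+1 = a.1.1.1]
  `&` [set a : W | a.1.2 0%N = a.1.1.1].
have sC I : souslin (C I).
  apply: souslin_bigcap => i; case: (leqP i I) => iI; last first.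
    rewrite (_ : mkset _ = setT); first exact/closed_souslin/closedT.
    by apply/seteqP; split.
  have := @souslin_preimage _ _ (fun a : W => (a.1.2 i, a.2 i)) _ _ sG.
  rewrite (_ : _ @^-1` _ = [set a : W | true -> Gamma (a.1.2 i, a.2 i)]).
    by apply => a; exact: (cvg_pair (cw i a) (cz i a)).
  by apply/seteqP; split => [a aG _|a]//; apply.
have sE I : souslin (E I).
  apply: souslinI; first apply: souslinI.
  - by have [] := bisouslin_eq (cz I) cx2.
  - by have [] := bisouslin_eq (cw I.+1) cx1.
  - by have [] := bisouslin_eq (cw 0%N) cx1.
have sS I : souslin [set a : W | sumW I a = 0%E].
  suff [] : bisouslin [set a : W | sumW I a = 0%E] by [].
  apply: (measurable_g_sigma_algebra (@sigma_algebra_bisouslin W)).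
  rewrite -[X in measurable X]setTI; apply: measurable_eqe => //.
  apply: emeasurable_sum => i; apply: emeasurable_funB; apply: mD => //.
have sX := polish_souslin_space sepX.
have sXN := souslin_space_ptws sX.
rewrite (_ : Gamma' _ _ = \bigcup_I [set p | exists w : {ptws nat -> X},
    exists z : {ptws nat -> X}, (C I `&` E I `&` [set a : W | sumW I a = 0%E])
    (p, w, z)]).
  apply: souslin_bigcup => I.
  exact: (souslin_projection sXN (souslin_projection sXN
    (souslinI (souslinI (sC I) (sE I)) (sS I)))).
apply/seteqP; split.
  move=> p [I [w [z [Gwz zI wI w0 S0]]]]; exists I => //; exists w, z.
  split => //; split; first by move=> i _; exact: Gwz.
  by rewrite /E; split => //; split.
move=> p [I _ [w [z]]]; rewrite /C /E => -[[Cwz [[zI wI] w0]] S0].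
exists I, w, z; split => //.
by move=> i; exact: Cwz.
Qed.

Lemma strict_domains_souslin (Gamma : set (X * X)) : sigma_compact Gamma ->
  souslin (fst @` (rel_inv (Grel dN Gamma) `\` @diag R X)) /\
  souslin (fst @` (Grel dN Gamma `\` @diag R X)).
Proof.
move=> /Gamma'_souslin/Grel_souslin sG.
have sX := polish_souslin_space sepX.
have cswap : continuous (fun p : X * X => (p.2, p.1)).
  by move=> p; exact: (cvg_pair cvg_snd cvg_fst).
have [_ sND] : bisouslin (@diag R X).
  by apply: bisouslin_eq => p; [exact: cvg_fst|exact: cvg_snd].
have fstE (A : set (X * X)) : fst @` A = [set x | exists y, A (x, y)].
  apply/seteqP; split => [_ [[x y] Axy <-]|x [y Axy]]; first by exists y.
  by exists (x, y).
rewrite !fstE; split; apply: souslin_projection => //; apply: souslinI => //.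
exact: (souslin_preimage cswap sG).
Qed.

(** The points at which the comparison of the two topologies fails at the scales
[r] and [e]. *)
Lemma dN_ball_exit_souslin (r : \bar R) (e : R) :
  souslin [set x | exists y, (dN x y < r)%E /\ ~ ball x e y].
Proof.
have sX := polish_souslin_space sepX.
have [sr _] : bisouslin [set p : X * X | (dN p.1 p.2 < r)%E].
  apply: (@bisouslin_dN _ fst snd [set t | (t < r)%E]).
  - by move=> p; exact: cvg_fst.
  - by move=> p; exact: cvg_snd.
  - rewrite (_ : mkset _ = `]-oo, r[%classic).
      exact: emeasurable_itv.
    by apply/seteqP; split => t; rewrite /= in_itv.
apply: (souslin_projection sX (A := [set p : X * X | (dN p.1 p.2 < r)%E] `&`
  [set p : X * X | ~ ball p.1 e p.2])).
apply: souslinI => //; apply: closed_souslin; apply: open_closedC.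
rewrite openE => -[x y] /=; rewrite ballEmdist/= => xy.
have d0 : 0 < (e - mdist x y) / 2 by rewrite divr_gt0// subr_gt0.
exists (ball x ((e - mdist x y) / 2), ball y ((e - mdist x y) / 2)).
  by split; exact: nbhsx_ballx.
move=> [x' y'] [/= xx' yy'].
move: xx' yy'; rewrite !ballEmdist/= metric_sym => x'x yy'.
have := metric_triangle x' x y'; have := metric_triangle x y y'.
lra.
Qed.

End transport_souslin.
(** * Outer measure and Caratheodory measurability *)

Section outer_measure.
Context d (T : measurableType d) (R : realType).
Variable mu : {finite_measure set T -> \bar R}.
Implicit Types A K : set T.
Local Notation mus := (mu_ext mu).

Lemma mu_ext_measurable A : measurable A -> mus A = mu A.
Proof. exact: measurable_mu_extE. Qed.

Lemma mu_ext_fin_num A : mus A \is a fin_num.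
Proof.
rewrite ge0_fin_numE; last exact: outer_measure_ge0.
apply: (@le_lt_trans _ _ (mu setT)).
  by rewrite -mu_ext_measurable//; exact: le_outer_measure.
by rewrite ltey_eq fin_num_measure.
Qed.

Lemma measurable_hull A :
  exists B, [/\ measurable B, A `<=` B & mu B = mus A].
Proof.
have : forall n : nat, exists B, [/\ measurable B, A `<=` B &
    (mu B <= mus A + n.+1%:R^-1%:E)%E].
  move=> n.
  have n0 : 0 < n.+1%:R^-1 :> R by [].
  have [_ [F [mF AF] <-]] := lb_ereal_inf_adherent n0 (mu_ext_fin_num A).
  move=> /ltW FA; exists (\bigcup_k F k); split => //.
    exact: bigcupT_measurable.
  apply: (le_trans _ FA); apply: measure_sigma_subadditive => //.
  exact: bigcupT_measurable.
move=> /choice[B AB]; exists (\bigcap_n B n).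
have mB : measurable (\bigcap_n B n).
  by apply: bigcapT_measurable => n; case: (AB n).
have sAB : A `<=` \bigcap_n B n by move=> x Ax n _; have [_ + _] := AB n; apply.
split => //; apply/eqP; rewrite eq_le; apply/andP; split; last first.
  by rewrite -(mu_ext_measurable mB); exact: le_outer_measure.
apply/lee_addgt0Pr => e e0.
have [n _ /(_ n (leqnn n)) ne] := near_infty_natSinv_lt (PosNum e0).
have [mBn _ Bn] := AB n; apply: (@le_trans _ _ (mu (B n))).
  by apply: le_measure; rewrite ?inE//; exact: bigcap_inf.
by apply: (le_trans Bn); rewrite leeD2l// lee_fin ltW.
Qed.

(** Continuity from below holds for arbitrary sets: replacing the [k]-th set by
the intersection of the hulls of the sets from the [k]-th one on gives an increasing sequence of
measurable sets with the same outer measures. *)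
Lemma mu_ext_bigcup_approx (A : nat -> set T) (e : R) :
  nondecreasing_seq A -> 0 < e ->
  exists n, (mus (\bigcup_k A k) <= mus (A n) + e%:E)%E.
Proof.
move=> ndA e0; have /choice[B AB] := fun n => measurable_hull (A n).
have mB n : measurable (B n) by case: (AB n).
pose C n := \bigcap_(k in [set k | (n <= k)%N]) B k.
have mC n : measurable (C n) by apply: bigcap_measurable => //; exists n => /=.
have ndC : nondecreasing_seq C.
  move=> m n mn; apply/subsetPset => x Cx k /= nk; apply: Cx.
  exact: leq_trans nk.
have AC n : A n `<=` C n.
  move=> x Anx k /= nk; have [_ + _] := AB k; apply.
  by have /subsetPset := ndA _ _ nk; apply.
have mUC : measurable (\bigcup_n C n) by exact: bigcupT_measurable.
have cvgC := nondecreasing_cvg_mu (mu := mu) mC mUC ndC.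
have fC : mu (\bigcup_n C n) \is a fin_num by exact: fin_num_measure.
pose c := (mu (\bigcup_n C n) - e%:E)%E.
have ltc : (c < mu (\bigcup_n C n))%E.
  by rewrite lteBlDr// lteDl// lte_fin.
have nbC : nbhs (mu (\bigcup_n C n)) [set y | (c < y)%E].
  by apply: open_nbhs_nbhs; split => //; exact: open_ereal_gt_ereal.
have [n _ /(_ n (leqnn n)) nP] := cvgC _ nbC.
exists n; apply: (@le_trans _ _ (mu (\bigcup_n C n))).
  rewrite -(mu_ext_measurable mUC); apply: le_outer_measure.
  exact: subset_bigcup.
rewrite /= /c lteBlDr// in nP; apply: (le_trans (ltW nP)); rewrite leeD2r//.
have [mBn _ <-] := AB n; apply: le_measure; rewrite ?inE//.
by move=> x; apply => /=.
Qed.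

Lemma caratheodory_inner_approx A :
  (forall e : R, 0 < e -> exists K,
    [/\ measurable K, K `<=` A & (mus A <= mu K + e%:E)%E]) ->
  mus.-caratheodory A.
Proof.
move=> innerA; apply: le_caratheodory_measurable => Y.
apply/lee_addgt0Pr => e e0; have [K [mK KA AK]] := innerA e e0.
have [B [mB AB BA]] := measurable_hull A.
have small : (mus (A `\` K) <= e%:E)%E.
  apply: (@le_trans _ _ (mu (B `\` K))).
    rewrite -mu_ext_measurable; last exact: measurableD.
    by apply: le_outer_measure; exact: setSD.
  have -> : (mu (B `\` K) = mu B - mu K)%E.
    rewrite measureD// ?ltey_eq ?fin_num_measure//; congr (_ - mu _)%E.
    by apply/setIidPr; exact: subset_trans AB.
  by rewrite leeBlDl ?fin_num_measure// BA.
have cK : mus.-caratheodory K by exact: caratheodory_measurable_mu_ext.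
change (mus (Y `&` A) + mus (Y `&` ~` A) <= mus Y + e%:E)%E.
rewrite (cK Y) addeAC; apply: leeD; last first.
  by apply: le_outer_measure; apply: setIS; exact: subsetC.
apply: (@le_trans _ _ (mus ((Y `&` K) `|` (A `\` K)))).
  apply: le_outer_measure => x [Yx Ax].
  by have [Kx|nKx] := pselect (K x); [left|right].
by apply: (le_trans (outer_measureU2 _ _ _)); rewrite leeD2l.
Qed.

(** The complement of a hull of the complement. *)
Lemma caratheodory_measurable_kernel A : mus.-caratheodory A ->
  exists B, [/\ measurable B, B `<=` A & mu B = mus A].
Proof.
move=> cA; have [B [mB AB BA]] := measurable_hull (~` A).
exists (~` B); split; first exact: measurableC.
  by rewrite -(setCK A); exact: subsetC.
have := cA setT; rewrite !setTI -BA (mu_ext_measurable measurableT).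
have -> : mu setT = (mu B + mu (~` B))%E.
  by rewrite -(setUv B) measureU//; [exact: measurableC|exact: setICr].
have fB : mu B \is a fin_num by exact: fin_num_measure.
have fCB : mu (~` B) \is a fin_num by apply: fin_num_measure; exact: measurableC.
rewrite -(fineK fB) -(fineK fCB) -(fineK (mu_ext_fin_num A)) -!EFinD => -[E].
by congr EFin; lra.
Qed.

End outer_measure.

(** * Souslin sets are Caratheodory measurable *)

(** Koenig's lemma: although the witness of order [n] is bounded only up to [n], an
ultrafilter on the witnesses decides each of their terms, because a bounded
term takes finitely many values, and the sequence of the decided terms is a
witness for [z]. *)
Lemma souslin_bounded_branch (Z : topologicalType)
    (P : nat -> (nat -> nat) -> set Z) (b : nat -> nat) (z : Z) :
  (forall j s, closed (P j s)) -> (forall j, finitely_determined (P j)) ->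
  (forall n, closure [set z' | exists s, (forall i, (i < n)%N -> (s i <= b i)%N) /\
     forall j, P j s z'] z) ->
  exists s, forall j, P j s z.
Proof.
move=> cP fP zb.
pose near_branch (U : set Z * nat) := [set s | (forall i, (i < U.2)%N ->
  (s i <= b i)%N) /\ exists2 z', U.1 z' & forall j, P j s z'].
pose F := filter_from [set U : set Z * nat | nbhs z U.1] near_branch.
have FF : ProperFilter F.
  apply: filter_from_proper; last first.
    move=> [U n] /= zU; have [z' [[s [sb Ps]] Uz']] := zb n U zU.
    by exists s; split => //; exists z'.
  apply: filter_from_filter; first by exists (setT, 0%N); exact: filterT.
  move=> [U n] [V m] /= zU zV.
  exists (U `&` V, maxn n m); first exact: filterI.
  move=> s [/= sb [z' [Uz' Vz'] Ps]]; split; (split => /=; last by exists z') => i lti;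
    by apply: sb; rewrite leq_max lti ?orbT.
have [G [UG FG]] := ultraFilterLemma FF.
have /choice[v Gv] : forall i, exists v, G [set s | s i = v].
  move=> i.
  have : G [set s | (s i <= b i)%N].
    apply: FG; exists (setT, i.+1); first exact: filterT.
    by move=> s [/= sb _]; exact: sb.
  elim: (b i) => [|c IHc] Gc.
    by exists 0%N; apply: filterS Gc => s /=; rewrite leqn0 => /eqP.
  have [/IHc//|Gcc] := in_ultra_setVsetC [set s : nat -> nat | (s i <= c)%N] UG.
  exists c.+1; apply: filterS2 Gc Gcc => s /= sc /negP.
  by rewrite -ltnNge => cs; apply/eqP; rewrite eqn_leq sc.
exists v => j; apply: contrapT => nP; have [N PN] := fP j v.
have GN : G [set s | forall i, (i < N)%N -> s i = v i].
  elim: (N) => [|M IHM]; first by apply: filterS filterT.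
  apply: filterS2 IHM (Gv M) => s /= sM sv i.
  by rewrite ltnS leq_eqVlt => /orP[/eqP->|/sM].
have GP : G (near_branch (~` P j v, 0%N)).
  apply: FG; exists (~` P j v, 0%N) => //=.
  by apply: open_nbhs_nbhs; split => //; exact/closed_openC/cP.
have [s [/PN PE [_ [z' /= nPz' Psz']]]] := filter_ex (filterI GN GP).
by apply: nPz'; rewrite -PE.
Qed.

Section souslin_caratheodory.
Context {R : realType} {X : completeMetricType R}.
Variable mu : {finite_measure set (borel X) -> \bar R}.
Local Notation mus := (mu_ext mu).

Lemma closed_borel (A : set X) : closed A -> measurable (A : set (borel X)).
Proof.
move=> cA; rewrite -(setCK A); apply: measurableC.
by apply: sub_sigma_algebra; exact: closed_openC.
Qed.

(** Choquet's capacitability argument.  The terms of the witnesses are bounded one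
after the other, by [b 0], [b 1] and so on, each time losing at most
[e / 2 ^+ n.+1] of outer measure, by continuity from below.  The intersection
of the closures of the sets obtained in this way is included in [A], by
[souslin_bounded_branch]. *)
Lemma souslin_inner_closed (A : set X) (e : R) : souslin A -> 0 < e ->
  exists K, [/\ closed K, K `<=` A & (mus A <= mu K + e%:E)%E].
Proof.
move=> [P [cP fP AE]] e0.
(* The part of [A] whose witnesses have their first terms bounded by [u]. *)
pose B (u : seq nat) : set X := [set z | exists s,
  (forall i, (i < size u)%N -> (s i <= nth 0%N u i)%N) /\ forall j, P j s z].
have B0 : B [::] = A.
  rewrite AE; apply/seteqP; split => [z [s [_ Ps]]|z [s Ps]]; first by exists s.
  by exists s.
have BS u : B u = \bigcup_v B (rcons u v).
  apply/seteqP; split => [z [s [su Ps]]|z [v _ [s [su Ps]]]].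
    exists (s (size u)) => //; exists s; split => // i.
    rewrite size_rcons ltnS leq_eqVlt nth_rcons => /orP[/eqP->|iu].
      by rewrite ltnn eqxx.
    by rewrite iu; exact: su.
  exists s; split => // i iu; have := su i; rewrite size_rcons nth_rcons iu.
  by apply; rewrite ltnS ltnW.
have ndB u : nondecreasing_seq (fun v => B (rcons u v)).
  move=> v w vw; apply/subsetPset => z [s [su Ps]]; exists s; split => // i iu.
  rewrite size_rcons in iu; have := su i; rewrite size_rcons !nth_rcons => /(_ iu).
  by case: ifP => // _; case: ifP => // _ /leq_trans; apply.
have e2 n : 0 < e / 2 ^+ n by rewrite divr_gt0// exprn_gt0.
have /choice[f fB] : forall u, exists v,
    (mus (B u) <= mus (B (rcons u v)) + (e / 2 ^+ (size u).+1)%:E)%E.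
  move=> u; rewrite (BS u).
  exact: mu_ext_bigcup_approx.
pose u := fix u n := if n is k.+1 then rcons (u k) (f (u k)) else [::].
have szu n : size (u n) = n by elim: n => //= n IH; rewrite size_rcons IH.
pose b i := f (u i).
have nthu n i : (i < n)%N -> nth 0%N (u n) i = b i.
  elim: n => //= n IH; rewrite ltnS leq_eqVlt nth_rcons szu => /orP[/eqP->|iltn].
    by rewrite ltnn eqxx.
  by rewrite iltn IH.
have muB n : (mus A + (e / 2 ^+ n)%:E <= mus (B (u n)) + e%:E)%E.
  elim: n => [|n IH]; first by rewrite /= B0 expr0 divr1.
  have := fB (u n); rewrite szu => step.
  move: IH step; rewrite -(fineK (mu_ext_fin_num mu A)) /=.
  rewrite -(fineK (mu_ext_fin_num mu (B (u n)))).
  rewrite -(fineK (mu_ext_fin_num mu (B (rcons (u n) (f (u n)))))).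
  rewrite -!EFinD !lee_fin.
  have -> : e / 2 ^+ n = e / 2 ^+ n.+1 + e / 2 ^+ n.+1.
    by rewrite exprS invfM (mulrC 2^-1) mulrA -splitr.
  by move=> h1 h2 /=; lra.
pose K n := closure (B (u n)).
have mK n : measurable (K n : set (borel X)) 
  by apply: closed_borel; exact: closed_closure.
have cK : closed (\bigcap_n K n) by apply: closed_bigI => n _; exact: closed_closure.
exists (\bigcap_n K n); split => //.
  rewrite AE => z Kz; apply: (souslin_bounded_branch (b := b) cP fP) => n.
  rewrite (_ : mkset _ = B (u n)); first exact: Kz.
  apply/seteqP; split => z' [s [sb Ps]]; exists s; split => // i.
    by rewrite szu => iltn; rewrite nthu//; exact: sb.
  by move=> iltn; rewrite -(nthu n)//; apply: sb; rewrite szu.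
have niK : nonincreasing_seq K.
  apply/nonincreasing_seqP => n; apply/subsetPset; apply: closureS => /=.
  by move=> z Bz; rewrite (BS (u n)); exists (f (u n)).
have fK : (mu (K 0%N) < +oo)%E by rewrite ltey_eq fin_num_measure.
have := nonincreasing_cvg_mu (mu := mu) fK mK (closed_borel cK) niK.
move=> /cvg_lim => /(_ (@ereal_hausdorff R)) muK.
rewrite -leeBlDr// -muK; apply: lime_ge.
  apply: ereal_nonincreasing_is_cvgn => m n mn; apply: le_measure; rewrite ?inE//.
  by apply/subsetPset; exact: niK.
apply: nearW => n; rewrite leeBlDr//.
apply: (@le_trans _ _ (mus A + (e / 2 ^+ n)%:E)%E).
  by rewrite leeDl// lee_fin ltW.
apply: (le_trans (muB n)); apply: leeD2r; apply: (@le_trans _ _ (mus (K n))).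
  by apply: le_outer_measure; exact: subset_closure.
by rewrite mu_ext_measurable.
Qed.

Lemma souslin_caratheodory (A : set X) : souslin A -> mus.-caratheodory A.
Proof.
move=> sA; apply: caratheodory_inner_approx => e e0.
have [K [cK KA AK]] := souslin_inner_closed sA e0.
by exists K; split => //; exact: closed_borel.
Qed.

End souslin_caratheodory.
(** * Vanishing of antichains *)

Section egorov.
Context d (T : measurableType d) (R : realType).
Variable mu : {finite_measure set T -> \bar R}.
Local Notation mus := (mu_ext mu).

(** The set-theoretic core of Egorov's theorem: at the cost of a small part of
[A], the index [k] such that a point lies in [F j k] is uniform for each [j]. *)
Lemma mu_ext_bigcap_approx (A : set T) (F : nat -> nat -> set T) (e : R) :
  (forall j k, mus.-caratheodory (F j k)) ->
  (forall j, nondecreasing_seq (F j)) -> (forall j, \bigcup_k F j k = setT) ->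
  0 < e ->
  exists k : nat -> nat, (mus A <= mus (A `&` \bigcap_j F j (k j)) + e%:E)%E.
Proof.
move=> cF ndF UF e0.
have /choice[k kP] : forall j, exists k,
    (mus (A `&` ~` F j k) <= (e / (2 ^ j.+1)%:R)%:E)%E.
  move=> j.
  have ndAF : nondecreasing_seq (fun k => A `&` F j k).
    by move=> m n mn; apply/subsetPset; apply: setIS; apply/subsetPset; exact: ndF.
  have ej : 0 < e / (2 ^ j.+1)%:R by rewrite divr_gt0// ltr0n expn_gt0.
  have [k] := mu_ext_bigcup_approx mu ndAF ej.
  rewrite -setI_bigcupr UF setIT => Ak; exists k; move: Ak.
  rewrite [X in (X <= _)%E](cF j k A).
  rewrite -(fineK (mu_ext_fin_num mu (A `&` F j k))).
  rewrite -(fineK (mu_ext_fin_num mu (A `&` ~` F j k))).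
  by rewrite -!EFinD !lee_fin lerD2l.
exists k; set B := \bigcap_j _.
apply: (@le_trans _ _ (mus ((A `&` B) `|` \bigcup_j (A `&` ~` F j (k j))))).
  apply: le_outer_measure => x Ax.
  have [Bx|nBx] := pselect (B x); [by left|right].
  apply: contrapT => nx; apply: nBx => j _; apply: contrapT => nF; apply: nx.
  by exists j.
apply: (le_trans (outer_measureU2 _ _ _)); apply: leeD2l.
apply: (le_trans (outer_measure_sigma_subadditive _ _)).
apply: (le_trans _ (epsilon_trick0 xpredT (ltW e0))).
apply: lee_nneseries => [j _ _|j _]; first exact: outer_measure_ge0.
exact: kP.
Qed.

End egorov.

Lemma natSinv_lt_ereal (R : realType) (x : \bar R) : (0 < x)%E ->
  exists k : nat, (k.+1%:R^-1%:E < x)%E.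
Proof.
case: x => [x| |]//; last by exists 0%N; rewrite ltry.
rewrite lte_fin => x0.
have [k _ /(_ k (leqnn k)) kx] := near_infty_natSinv_lt (PosNum x0).
by exists k; rewrite lte_fin.
Qed.

Section antichain.
Context {R : realType} {X : completeMetricType R} (sepX : separable X).
Context (dN : X -> X -> \bar R).
Hypothesis dN_dist : extended_distance dN.
Hypothesis dN_borel : measurable_fun setT
  ((fun p => dN p.1 p.2) : borel (X * X)%type -> \bar R).
Hypothesis dN_geodesic : geodesic dN.

(** A point [y] at small [dN]-distance is reached by an admissible path of that
length, whereas paths that leave the ball have lengths bounded from below. *)
Lemma geodesic_topology (x : X) (e : R) : 0 < e ->
  exists k : nat, forall y, (dN x y < k.+1%:R^-1%:E)%E -> ball x e y.
Proof.
move=> e0; have [Ls LsE] := dN_geodesic.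
have := len_topology Ls (nbhsx_ballx x e e0).
set L := (X in ereal_inf X) => L0.
have [k kL] := natSinv_lt_ereal L0.
exists k => y xy; apply: contrapT => nxy.
have [_ Lfin] := LsE x y.
have [a [b [g [ag ga gb lg]]]] := Lfin (lt_trans xy (ltry _)).
have : (ereal_inf L <= dN x y)%E.
  by apply: ereal_inf_lbound; exists a, b, g; split => //; rewrite gb.
by rewrite leNgt (lt_trans xy kL).
Qed.

Variable (Gamma : set (X * X)).

Lemma translateP (A : set X) (t : R) (y : X) : translate dN Gamma A t y ->
  exists x, [/\ A x, Rrel dN Gamma (x, y) & dN x y = `|t|%:E].
Proof.
rewrite /translate; case: leP => t0 -[[x y'] /= [Gxy Ax xy] <-]; exists x.
  by rewrite ger0_norm//; split => //; left.
by rewrite ltr0_norm//; split => //; right.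
Qed.

Variable mu : probability (borel X) R.
Local Notation mus := (mu_ext mu).
Hypothesis mu_nondegenerate : translation_nondegenerate dN Gamma mu.

Definition antichain (A : set X) : Prop :=
  forall x y, A x -> A y -> Rrel dN Gamma (x, y) -> x = y.

Lemma closed_analytic (E : set X) : closed E -> analytic E.
Proof.
move=> cE; exists X, (fst @^-1` E); split => //.
  rewrite -(setCK (fst @^-1` E)); apply: measurableC.
  apply: sub_sigma_algebra; apply: closed_openC.
  by apply: closed_comp => // p _; exact: cvg_fst.
by apply/seteqP; split => [x Ex|_ [p Ep <-]//]; exists (x, x).
Qed.

(** The translates of [E] are disjoint from [E], since an antichain contains no
point related to another of its points, and they are squeezed between [E] and
its metric neighbourhoods, which shrink to [E] as [E] is closed. *)
Lemma closed_uniform_antichain_null (E : set X) (k : nat -> nat) :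
  closed E -> E `<=` Te dN Gamma -> antichain E ->
  (forall j x y, E x -> (dN x y < (k j).+1%:R^-1%:E)%E -> ball x j.+1%:R^-1 y) ->
  mu E = 0%E.
Proof.
move=> cE ETe acE Ek.
have [t [C [t0 cvgt C0 tE]]] := mu_nondegenerate (closed_analytic cE) ETe.
pose N j := closure [set y | exists2 x, E x & ball x j.+1%:R^-1 y].
have cN j : closed (N j) by exact: closed_closure.
have mE : measurable (E : set (borel X)) by exact: closed_borel.
have mN j : measurable (N j : set (borel X)) by exact: closed_borel.
have mV j : measurable (N j `\` E : set (borel X)) by exact: measurableD.
have ltSinv i j : (i <= j)%N -> j.+1%:R^-1 <= i.+1%:R^-1 :> R.
  by move=> ij; rewrite lef_pV2 ?posrE// ler_nat.
have capN : \bigcap_j (N j `\` E) = set0.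
  apply/seteqP; split => // y yN; have [_ nEy] := yN 0%N I.
  apply: nEy; rewrite (closure_id E).1// => V; rewrite -nbhs_ballE => -[e /= e0 yV].
  have e20 : 0 < e / 2 by rewrite divr_gt0.
  have [j _ /(_ j (leqnn j)) je] := near_infty_natSinv_lt (PosNum e20).
  have [Ny _] := yN j I.
  have [y' [[x Ex xy'] yy']] := Ny _ (nbhsx_ballx y (e / 2) e20).
  exists x; split => //; apply: yV; rewrite (splitr e).
  by apply: (ball_triangle yy'); apply: ball_sym; apply: le_ball xy'; exact: ltW.
have niV : nonincreasing_seq (fun j => N j `\` E).
  move=> i j ij; apply/subsetPset; apply: setSD; apply: closureS => y [x Ex xy].
  by exists x => //; apply: le_ball xy; exact: ltSinv.
have CV j : (C%:E * mu E <= mu (N j `\` E))%E.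
  have k0 : 0 < (k j).+1%:R^-1 :> R by [].
  have [n _ /(_ n (leqnn n)) tn] := cvgr0_norm_lt _ cvgt _ k0.
  rewrite -(mu_ext_measurable mu mE) -(mu_ext_measurable mu (mV j)).
  apply: (le_trans (tE n)); apply: le_outer_measure => y /translateP[x [Ex xy dxy]].
  split.
    by apply: subset_closure; exists x => //; apply: (Ek j) => //; rewrite dxy lte_fin.
  move=> Ey; have xyE := acE _ _ Ex Ey xy.
  have [_ dN0 _ _] := dN_dist.
  move: dxy; rewrite xyE (dN0 y y).2// => -[] /esym/eqP; rewrite normr_eq0.
  exact/negP/t0.
have fV : (mu (N 0%N `\` E) < +oo)%E by rewrite ltey_eq fin_num_measure.
have m0 : measurable (\bigcap_j (N j `\` E) : set (borel X)) by rewrite capN.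
have := nonincreasing_cvg_mu (mu := mu) fV mV m0 niV; rewrite capN measure0 => V0.
have : (C%:E * mu E <= 0)%E.
  rewrite -(cvg_lim (@ereal_hausdorff R) V0); apply: lime_ge; last exact: nearW.
  by apply/cvg_ex; exists 0%E.
by rewrite pmule_rle0 ?lte_fin// measure_le0 => /eqP.
Qed.

(** Reduction to [closed_uniform_antichain_null]: [F j k] is the set of points
whose [dN]-ball of radius [1 / k.+1] is included in the metric ball of radius
[1 / j.+1]. *)
Lemma antichain_null (A : set X) :
  mus.-caratheodory A -> A `<=` Te dN Gamma -> antichain A -> mus A = 0%E.
Proof.
move=> cA ATe acA; apply/eqP; rewrite eq_le outer_measure_ge0 andbT.
rewrite leNgt; apply/negP => A0.
pose F (j k : nat) : set X := ~` [set x | exists y, (dN x y < k.+1%:R^-1%:E)%E /\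
  ~ ball x j.+1%:R^-1 y].
have cF j k : mus.-caratheodory (F j k).
  apply: caratheodory_measurable_setC; apply: souslin_caratheodory.
  exact: dN_ball_exit_souslin.
have FP j k x : F j k x <->
    forall y, (dN x y < k.+1%:R^-1%:E)%E -> ball x j.+1%:R^-1 y.
  split => [Fx y xy|xF [y [xy]]]; last by apply; exact: xF.
  by apply: contrapT => nxy; apply: Fx; exists y.
have ndF j : nondecreasing_seq (F j).
  move=> m n mn; apply/subsetPset => x /FP xm; apply/FP => y xy; apply: xm.
  by apply: (lt_le_trans xy); rewrite lee_fin lef_pV2 ?posrE// ler_nat.
have UF j : \bigcup_k F j k = setT.
  apply/seteqP; split => // x _.
  by have [|k kx] := @geodesic_topology x j.+1%:R^-1; [|exists k => //; apply/FP].
have fA : mus A \is a fin_num by exact: mu_ext_fin_num.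
(* Two approximations follow; any divisor larger than 2 would do. *)
pose e := fine (mus A) / 4.
have e0 : 0 < e by rewrite divr_gt0// fine_gt0// A0 ltey_eq fA.
have [k Ak] := @mu_ext_bigcap_approx _ (borel X) R mu A F e cF ndF UF e0.
set B := A `&` _ in Ak.
have cB : mus.-caratheodory B.
  apply: caratheodory_measurable_setI => //.
  rewrite -(setCK (\bigcap_j _)) setC_bigcap; apply: caratheodory_measurable_setC.
  by apply: caratheodory_measurable_bigcup => j; exact: caratheodory_measurable_setC.
have [K [mK KB KE]] := caratheodory_measurable_kernel cB.
have [sK _] := borel_bisouslin mK.
have [E [cE EK EKe]] := souslin_inner_closed mu sK e0.
have EB : E `<=` B by exact: subset_trans KB.
have E0 : mu E = 0%E.
  apply: (closed_uniform_antichain_null (k := k)) => //.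
  - by move=> x /EB[/ATe].
  - by move=> x y /EB[Ax _] /EB[Ay _]; exact: acA.
  - by move=> j x y /EB[_ /(_ j I)/FP]; exact.
have {}EKe : (mus B <= mu E + e%:E)%E by rewrite -[mus B]KE -mu_ext_measurable.
move: EKe Ak; rewrite E0 add0e.
rewrite -(fineK (mu_ext_fin_num mu B)) -(fineK fA) -EFinD !lee_fin => h1 h2.
have : fine (mus A) <= e + e by lra.
have : 0 < fine (mus A) by rewrite fine_gt0// A0 ltey_eq fA.
by rewrite /e; lra.
Qed.

End antichain.
(** * Atoms of the conditional probabilities *)

Section null_integral.
Context d (T : measurableType d) (R : realType).
Variable m : {measure set T -> \bar R}.

Import HBNNSimple.

(** The function [h] is arbitrary because the conditional probabilities of a Borel
set are only almost everywhere equal to a measurable function; the bound holds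
since the integral is the supremum of those of the simple functions below [h]. *)
Lemma ge_cst_le_integral (D A : set T) (h : T -> \bar R) (r : R) :
  measurable A -> A `<=` D -> 0 <= r ->
  (forall x, D x -> (0 <= h x)%E) -> (forall x, A x -> (r%:E <= h x)%E) ->
  (r%:E * m A <= \int[m]_(x in D) h x)%E.
Proof.
move=> mA AD r0 h0 rh; rewrite ge0_integralE//.
apply: ereal_sup_ubound; exists (scale_nnsfun (indic_nnsfun R mA) r0) => /=.
  change (forall x, ((r * \1_A x)%:E <= (h \_ D) x)%E) => x.
  rewrite /patch indicE.
  case: (boolP (x \in A)) => [/set_mem Ax|_].
    by rewrite (mem_set (AD _ Ax)) mulr1; exact: rh.
  by rewrite mulr0; case: ifPn => // /set_mem; exact: h0.
transitivity (r%:E * sintegral m (indic_nnsfun R mA))%E.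
  exact: (sintegralrM m r (indic_nnsfun R mA)).
by congr (_ * _)%E; exact: sintegral_indic.
Qed.

Lemma ae_measurable_integral_eq0 (S : set T) (h : T -> \bar R) :
  measurable S -> (forall y, S y -> (0 <= h y)%E) -> ae_measurable m S h ->
  (\int[m]_(y in S) h y = 0)%E -> {ae m, forall y, S y -> h y = 0%E}.
Proof.
move=> mS h0 [g mg [Z [mZ Z0 SZ]]] int0.
have hg y : S y -> ~ Z y -> h y = g y.
  by move=> Sy nZy; apply: contrapT => nhg; apply: nZy; apply: SZ => /(_ Sy).
pose A (n : nat) := (S `\` Z) `&` [set y | (n.+1%:R^-1%:E <= g y)%E].
have mA n : measurable (A n).
  apply: measurableI; first exact: measurableD.
  by rewrite -[X in measurable X]setTI; apply: measurable_lee.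
have mA0 n : m (A n) = 0%E.
  have : (n.+1%:R^-1%:E * m (A n) <= 0)%E.
    rewrite -int0; apply: ge_cst_le_integral => //.
    - by move=> y [[]].
    - by move=> y [[Sy nZy] /=]; rewrite hg.
  by rewrite pmule_rle0 ?lte_fin// measure_le0 => /eqP.
have nA : m.-negligible (\bigcup_n A n).
  by apply: negligible_bigcup => n; apply/(negligibleP m (mA n)); exact: mA0.
have nZ : m.-negligible Z by exact/(negligibleP m mZ).
apply: (negligibleS _ (negligibleU nZ nA)) => y /= nhy.
have [Zy|nZy] := pselect (Z y); [by left|right].
have [Sy hy] : S y /\ h y != 0%E.
  by apply: contrapT => nSh; apply: nhy => Sy; apply: contrapT => /eqP hy; apply: nSh.
have [k kh] : exists k : nat, (k.+1%:R^-1%:E < h y)%E.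
  by apply: natSinv_lt_ereal; rewrite lt_neqAle eq_sym hy h0.
by exists k => //; split => //=; rewrite -hg// ltW.
Qed.

End null_integral.

Section countable_base.
Context {R : realType} {X : completeMetricType R}.

Lemma separable_countable_base : separable X ->
  exists U : nat -> set X, (forall n, open (U n)) /\
    forall (x : X) (e : R), 0 < e -> exists n, U n x /\ U n `<=` ball x e.
Proof.
move=> /separable_dense_sequence[q dq].
exists (fun n => if unpickle n is Some (i, k)
  then (ball (q i) k.+1%:R^-1)^° else set0); split.
  by move=> n; case: unpickle => [[i k]|]; [exact: open_interior|exact: open0].
move=> x e e0; have e40 : 0 < e / 4 by rewrite divr_gt0.
have [k _ /(_ k (leqnn k)) ke] := near_infty_natSinv_lt (PosNum e40).
rewrite /= in ke.
have k0 : 0 < k.+1%:R^-1 :> R by [].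
have k20 : 0 < k.+1%:R^-1 / 2 :> R by rewrite divr_gt0.
have [p xp] := dq x _ k20.
exists (pickle (p, k)); rewrite pickleK.
split.
  rewrite /interior -nbhs_ballE; exists (k.+1%:R^-1 / 2) => //= y xy.
  by rewrite [k.+1%:R^-1]splitr; apply: (ball_triangle (ball_sym xp)).
move=> y /interior_subset py; apply: le_ball (ball_triangle xp py).
by move: (k.+1%:R^-1) ke k0 => r; lra.
Qed.

Variables (U : nat -> set X) (P : probability (borel X) R).
Hypothesis Uopen : forall n, open (U n).
Hypothesis Ubase : forall (x : X) (e : R), 0 < e ->
  exists n, U n x /\ U n `<=` ball x e.

Lemma open_borel (A : set X) : open A -> measurable (A : set (borel X)).
Proof. by move=> oA; exact: sub_sigma_algebra. Qed.

Lemma measurable_point (x : X) : measurable ([set x] : set (borel X)).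
Proof.
by apply: closed_borel; apply: accessible_closed_set1;
  apply: hausdorff_accessible; exact: metric_hausdorff.
Qed.

(** The sets of the base that contain [x] are as small as the balls around [x],
whose closures decrease to [x]. *)
Lemma base_cvg_point (x : X) (c : \bar R) : (P [set x] < c)%E ->
  exists n, U n x /\ (P (U n) < c)%E.
Proof.
move=> xc; pose D (n : nat) := closure (ball x n.+1%:R^-1).
have mD n : measurable (D n : set (borel X)).
  by apply: closed_borel; exact: closed_closure.
have capD : \bigcap_n D n = [set x].
  apply/seteqP; split => [y yD|_ -> n _]; last first.
    by apply: subset_closure; exact: ballxx.
  apply: (@metric_hausdorff _ X) => V W; rewrite -!nbhs_ballE.
  move=> [e /= e0 yV] [r /= r0 xW].
  have [n _ /(_ n (leqnn n)) nr] := near_infty_natSinv_lt (PosNum r0).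
  have [z [xz yz]] := yD n I (ball y e) (nbhsx_ballx y e e0).
  by exists z; split; [exact: yV|apply: xW; apply: le_ball xz; exact: ltW].
have niD : nonincreasing_seq D.
  move=> i j ij; apply/subsetPset; apply: closureS; apply: le_ball.
  by rewrite lef_pV2 ?posrE// ler_nat.
have fD : (P (D 0%N) < +oo)%E by rewrite ltey_eq fin_num_measure.
have mcapD : measurable (\bigcap_n D n : set (borel X)).
  by rewrite capD; exact: measurable_point.
have cvgD := nonincreasing_cvg_mu (mu := P) fD mD mcapD niD.
rewrite capD in cvgD.
have nbc : nbhs (P [set x]) [set y | (y < c)%E].
  by apply: open_nbhs_nbhs; split => //; exact: open_ereal_lt_ereal.
have [n _ /(_ n (leqnn n)) /= Dc] := cvgD _ nbc.
have [l [Ulx Ul]] := @Ubase x n.+1%:R^-1 (ltac:(by [])).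
exists l; split => //; apply: le_lt_trans Dc; apply: le_measure; rewrite ?inE//.
  exact: open_borel.
by apply: (subset_trans Ul); exact: subset_closure.
Qed.

Lemma base_neighbourhood_atom (x : X) : (0 < P [set x])%E ->
  exists n, U n x /\ (2%:E * P (U n) <= 3%:E * P [set x])%E.
Proof.
have fx : P [set x] \is a fin_num by apply: fin_num_measure; exact: measurable_point.
have mU n : measurable (U n : set (borel X)) by exact: open_borel.
move=> x0; have [|n [Ux Un]] := @base_cvg_point x ((3 / 2)%:E * P [set x])%E.
  rewrite -(fineK fx) -EFinM lte_fin.
  have : 0 < fine (P [set x]) by rewrite fine_gt0// x0 ltey_eq fx.
  lra.
exists n; split => //; move: Un.
rewrite -(fineK fx) -(fineK (fin_num_measure P _ (mU n))) -!EFinM lte_fin lee_fin.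
lra.
Qed.

(** The hypothesis on [x] says that it carries two thirds of the mass of [U k],
but through the countable base rather than through the mass of the point, so
that it is measurable in [x] and [P] together.  Two such points would carry
four thirds of the mass. *)
Lemma heavy_point_unique (k : nat) (x x' : X) : (0 < P (U k))%E ->
  U k x -> U k x' ->
  (forall l, U l x -> (2%:E * P (U k) <= 3%:E * P (U l))%E) ->
  (forall l, U l x' -> (2%:E * P (U k) <= 3%:E * P (U l))%E) -> x = x'.
Proof.
have mU n : measurable (U n : set (borel X)) by exact: open_borel.
have fU n : P (U n) \is a fin_num by exact: fin_num_measure.
have fx y : P [set y] \is a fin_num by apply: fin_num_measure; exact: measurable_point.
have heavy y : (forall l, U l y -> (2%:E * P (U k) <= 3%:E * P (U l))%E) ->
    2 * fine (P (U k)) <= 3 * fine (P [set y]).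
  move=> yU; rewrite leNgt; apply/negP => yk.
  have [|l [/yU + ]] := @base_cvg_point y (2 / 3 * fine (P (U k)))%:E.
    by rewrite -(fineK (fx y)) lte_fin; lra.
  rewrite -(fineK (fU k)) -(fineK (fU l)) -!EFinM lte_fin lee_fin /=.
  lra.
move=> Uk0 Ux Ux' /heavy hx /heavy hx'; apply: contrapT => xx'.
have : (P [set x] + P [set x'] <= P (U k))%E.
  rewrite -measureU//; [|exact: measurable_point|exact: measurable_point|].
    apply: le_measure; rewrite ?inE//.
      by apply: measurableU; exact: measurable_point.
    by move=> _ [->|->].
  by apply/seteqP; split => // _ [-> /xx'].
have : 0 < fine (P (U k)) by rewrite fine_gt0// Uk0 ltey_eq fU.
rewrite -(fineK (fU k)) -(fineK (fx x)) -(fineK (fx x')) -EFinD lee_fin /=.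
lra.
Qed.

End countable_base.
(** * Initial and final points, and the theorem *)

(** Of two related distinct points, one is the origin and the other is the target
of a nontrivial pair of [Grel]; so the points that are not the origin of any
such pair form an antichain, and likewise for targets. *)
Lemma endpoints_null (R : realType) (X : completeMetricType R)
    (sepX : separable X) (dN : X -> X -> \bar R)
    (dN_dist : extended_distance dN)
    (dN_borel : measurable_fun setT
       ((fun p => dN p.1 p.2) : borel (X * X)%type -> \bar R))
    (dN_geodesic : geodesic dN) (Gamma : set (X * X))
    (Gamma_sigma_compact : sigma_compact Gamma)
    (mu : probability (borel X) R)
    (mu_nondegenerate : translation_nondegenerate dN Gamma mu) :
  mu_ext mu (Te dN Gamma `\` Tset dN Gamma) = 0%E.
Proof.
have [sa sb] := strict_domains_souslin sepX dN_borel dN_dist Gamma_sigma_compact.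
rewrite /Te /Tset.
set a := fst @` (rel_inv _ `\` _) in sa *; set b := fst @` (_ `\` _) in sb *.
have ca := souslin_caratheodory mu sa; have cb := souslin_caratheodory mu sb.
have inb x y : Grel dN Gamma (x, y) -> x <> y -> b x by move=> ? ?; exists (x, y).
have ina x y : Grel dN Gamma (x, y) -> x <> y -> a y.
  by move=> Gxy xy; exists (y, x) => //; split => //= /esym.
have aNb : mu_ext mu (a `\` b) = 0%E.
  apply: (antichain_null sepX dN_dist dN_borel dN_geodesic mu_nondegenerate).
  - exact: caratheodory_measurable_setD.
  - by move=> x [ax _]; left.
  - move=> x y [_ nbx] [_ nby] xy; apply: contrapT => nxy; case: xy => [|] Gxy.
      by apply: nbx; exact: inb Gxy nxy.
    by apply: nby; apply: inb Gxy _ => /esym.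
have bNa : mu_ext mu (b `\` a) = 0%E.
  apply: (antichain_null sepX dN_dist dN_borel dN_geodesic mu_nondegenerate).
  - exact: caratheodory_measurable_setD.
  - by move=> x [bx _]; right.
  - move=> x y [_ nax] [_ nay] xy; apply: contrapT => nxy; case: xy => [|] Gxy.
      by apply: nay; exact: ina Gxy nxy.
    by apply: nax; apply: ina Gxy _ => /esym.
apply/eqP; rewrite eq_le outer_measure_ge0 andbT.
have -> : 0%E = (mu_ext mu (a `\` b) + mu_ext mu (b `\` a))%E :> \bar R.
  by rewrite aNb bNa adde0.
apply: le_trans (outer_measureU2 _ _ _); apply: le_outer_measure => x [].
move=> [ax|bx] nab; [left|right]; split => // ?; exact: nab.
Qed.

Theorem theorem1p1 (R : realType) (X : completeMetricType R)
    (sepX : separable X)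
    (dN : X -> X -> \bar R)
    (dN_dist : extended_distance dN)
    (dN_borel : measurable_fun setT
       ((fun p => dN p.1 p.2) : borel (X * X)%type -> \bar R))
    (dN_geodesic : geodesic dN)
    (mu nu : probability (borel X) R)
    (pi : probability (borel (X * X)%type) R)
    (pi_coupling : coupling mu nu pi)
    (pi_cost : (\int[pi]_p dN p.1 p.2 < +oo)%E)
    (Gamma : set (X * X))
    (Gamma_sigma_compact : sigma_compact Gamma)
    (Gamma_monotone : cyclically_monotone dN Gamma)
    (Gamma_finite : forall p, Gamma p -> (dN p.1 p.2 < +oo)%E)
    (pi_Gamma : concentrated_on pi Gamma)
    (Gamma_closed : chains_closed dN Gamma)
    (Gamma_bounded : chains_locally_bounded dN Gamma)
    (f : X -> X)
    (f_quotient : quotient_map dN Gamma mu f)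
    (m : {measure set (borel X) -> \bar R})
    (m_quotient : quotient_measure dN Gamma mu f m)
    (S : set X)
    (S_sigma_compact : sigma_compact S)
    (S_image : S `<=` f @` Tset dN Gamma)
    (S_carrier : concentrated_on m S)
    (mu_ : X -> probability (borel X) R)
    (mu_disintegration :
       strongly_consistent_disintegration dN Gamma mu f m S mu_)
    (mu_nondegenerate : translation_nondegenerate dN Gamma mu) :
  mu_ext mu (Te dN Gamma `\` Tset dN Gamma) = 0%E /\
  {ae m, forall y, S y -> forall x : X, mu_ y [set x] = 0%E}.

Proof.
split; first exact: (endpoints_null sepX dN_dist dN_borel dN_geodesic).
have [fT fH cTf] := f_quotient.
have [dm dint dconc] := mu_disintegration.
pose T := Tset dN Gamma.
have aeF : Filter (almost_everywhere m) := ae_filter_ringOfSetsType m.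
have mS : measurable (S : set (borel X)).
  have [K cK ->] := S_sigma_compact; apply: bigcupT_measurable => n.
  apply: closed_borel; apply: compact_closed (cK n); exact: metric_hausdorff.
have [U [oU baseU]] := separable_countable_base sepX.
have mU n : measurable (U n : set (borel X)) by exact: open_borel.
have /choice[g gP] : forall n, exists g : X -> \bar R,
    measurable_fun setT (g : borel X -> \bar R) /\
    {ae m, forall y, S y -> mu_ y (U n) = g y}.
  by move=> n; have [h mh hP] := dm _ (mU n); exists h.
have mg n : measurable_fun setT (g n : borel X -> \bar R) by have [] := gP n.
have aeg : {ae m, forall y, forall n, S y -> mu_ y (U n) = g n y}.
  by apply: ae_foralln => n; have [] := gP n.
have [Z [mZ Z0 ZP]] : {ae m, forall y, S y ->
    (forall n, mu_ y (U n) = g n y) /\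
    concentrated_on (mu_ y) (T `&` f @^-1` [set y])}.
  apply: (@filterS2 _ _ aeF _ _ _ _ aeg dconc) => y yg yc Sy.
  by split => [n|]; [exact: yg|exact: yc].
(* On [E] the masses of the basic open sets are measurable functions of [y]. *)
pose E := S `\` Z.
have EP y : E y -> (forall n, mu_ y (U n) = g n y) /\
    concentrated_on (mu_ y) (T `&` f @^-1` [set y]).
  move=> [Sy nZy]; suff : S y -> (forall n, mu_ y (U n) = g n y) /\
      concentrated_on (mu_ y) (T `&` f @^-1` [set y]) by apply.
  by apply: contrapT => ny; apply: nZy; exact: ZP.
pose pos k : set (borel X) := E `&` [set y | (0 < g k y)%E].
pose comp k l : set (borel X) := [set y | (2%:E * g k y <= 3%:E * g l y)%E].
have mpos k : measurable (pos k).
  apply: measurableI; first exact: measurableD.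
  by rewrite -[X in measurable X]setTI; apply: measurable_lte.
have mcomp k l : measurable (comp k l).
  rewrite /comp -[X in measurable X]setTI; apply: measurable_lee => //;
    exact: measurable_funeM.
(* The points of [U k] that carry two thirds of the mass given to [U k] by the
   conditional probability of their class. *)
pose A k := U k `&` (T `&` f @^-1` pos k) `&`
  \bigcap_l (~` U l `|` (T `&` f @^-1` comp k l)).
have A0 k : mu_ext mu (A k) = 0%E.
  apply: (antichain_null sepX dN_dist dN_borel dN_geodesic mu_nondegenerate).
  - have cU n : (mu_ext mu).-caratheodory (U n).
      exact: (caratheodory_measurable_mu_ext mu (mU n)).
    apply: caratheodory_measurable_setI.
      by apply: caratheodory_measurable_setI => //; exact: cTf.
    rewrite -(setCK (\bigcap_l _)) setC_bigcap; apply: caratheodory_measurable_setC.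
    apply: caratheodory_measurable_bigcup => l; apply: caratheodory_measurable_setC.
    apply: caratheodory_measurable_setU; last exact: cTf.
    exact: caratheodory_measurable_setC.
  - by move=> x [[_ [[ax _] _]] _]; left.
  - move=> x x' [[Ux [Tx [Ex gx]]] xl] [[Ux' [Tx' [Ex' gx']]] xl'] xx'.
    have fxx' : f x = f x'.
      apply: fH => //; split; [by left; case: Tx|by left; case: Tx'|].
      (* related points of [T] form a chain without intermediate points *)
      exists 0%N, (fun i => if i is 0%N then x else x'); split => //.
        by move=> i; rewrite leqn0 lt0n => /andP[/negPf->].
      by move=> i; rewrite leqn0 => /eqP ->.
    have [Pg _] := EP _ Ex.
    apply: (@heavy_point_unique _ _ U (mu_ (f x)) oU baseU k) => //.
    + by rewrite Pg.
    + by move=> l Ulx; rewrite !Pg; have [//|[]] := xl l I.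
    + move=> l Ulx'; rewrite !Pg; have [//|[_]] := xl' l I.
      by rewrite /= -fxx'.
have /choice[B BP] := fun k => measurable_hull mu (A k).
have mB k : measurable (B k) by case: (BP k).
have aeB : {ae m, forall y, forall k, S y -> mu_ y (B k) = 0%E}.
  apply: ae_foralln => k.
  apply: (@ae_measurable_integral_eq0 _ (borel X) R m S
    (fun y => mu_ y (B k)) mS (fun y _ => measure_ge0 _ _) (dm _ (mB k))).
  rewrite -(dint _ (mB k)); apply/eqP; rewrite eq_le outer_measure_ge0 andbT.
  have [_ _ Bk] := BP k; rewrite -(A0 k) -Bk -(mu_ext_measurable mu (mB k)).
  by apply: le_outer_measure; exact: subIsetl.
have aeZ : {ae m, forall y, ~ Z y}.
  by apply: (negligibleS _ ((negligibleP m mZ).2 Z0)) => y /= /contrapT.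
apply: (@filterS2 _ _ aeF _ _ _ _ aeB aeZ) => y yB nZy Sy x; apply: contrapT => /eqP x0.
have [Pg conc] := EP y (conj Sy nZy).
have mx := measurable_point x.
have {}x0 : (0 < mu_ y [set x])%E by rewrite lt_neqAle eq_sym x0 measure_ge0.
have [Tx fx] : (T `&` f @^-1` [set y]) x.
  apply: contrapT => nx; have : (mu_ y).-negligible [set x].
    by apply: negligibleS conc => _ ->.
  by move=> /(negligibleP (mu_ y) mx) x00; rewrite x00 ltxx in x0.
have ltxU n : U n x -> (mu_ y [set x] <= mu_ y (U n))%E.
  by move=> Unx; apply: le_measure; rewrite ?inE// => _ ->.
have [k [Ukx Uk]] := base_neighbourhood_atom oU baseU x0.
have Akx : A k x.
  split.
    split => //; split => //; rewrite /preimage /= fx; split => //=.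
    by rewrite -Pg; apply: (lt_le_trans x0); exact: ltxU.
  move=> l _; have [Ulx|nUlx] := pselect (U l x); [right|by left].
  split => //; rewrite /preimage /comp /= fx -!Pg.
  by apply: (le_trans Uk); apply: lee_wpmul2l => //; exact: ltxU.
have : (mu_ y [set x] <= mu_ y (B k))%E.
  apply: le_measure; [by rewrite inE|by rewrite inE; exact: mB|move=> _ ->].
  by have [_ + _] := BP k; apply.
by rewrite yB// leNgt x0.
Qed.
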